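(* For any pair of integers $r, s$ with $1\leq r< s$, the real numbers $1$, $\pi^r$ and $\pi^{s}$ are linearly independent over the algebraic integers. *)

(* Defs.v *)
From HB Require Import structures.
From mathcomp Require Import all_boot all_order all_algebra.
From mathcomp Require Import reals trigo.
From mathcomp Require Import complex.

Set Implicit Arguments.
Unset Strict Implicit.
Unset Printing Implicit Defensive.

Import Order.TTheory GRing.Theory Num.Theory.

Local Open Scope ring_scope.

Definition algebraic_integer (K : fieldType) (z : K) : Prop :=
  integralOver (intr : int -> K) z.

(* The scalars are given by a predicate [S] on K, meant to be a subring;
   [free] only covers scalars ranging over a whole field. *)
Definition lin_indep_over (K : fieldType) (S : K -> Prop) (n : nat)
    (v : n.-tuple K) : Prop :=
  forall c : 'I_n -> K, (forall i, S (c i)) ->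
    \sum_(i < n) c i * tnth v i = 0 -> forall i, c i = 0.

(* Main.v *)
Require Import Defs.
From HB Require Import structures.
From mathcomp Require Import all_boot all_order all_algebra.
From mathcomp Require Import reals trigo.
From mathcomp Require Import complex.
From mathcomp Require Import perm mpoly boolp functions topology normedtype.
From mathcomp Require Import sequences derive realfun exp ring.

(* A nontrivial relation between 1, pi^r and pi^s would make pi, hence i*pi,
   algebraic over Q; this contradicts Lindemann's theorem, proved as follows.
   Let c*i*pi be an algebraic integer, a_1, ..., a_n the roots in C of a monic
   integer polynomial vanishing at it, and b_S the sum of the a_j for j in S.
   Since exp(i*pi) = -1, expanding prod_j (1 + exp(a_j / c)) = 0 yields
   sum_S exp(b_S / c) = 0. By the theory of symmetric polynomials, sum_S h(b_S)
   is an integer for every h in Z[X], and prod_S (X - b_S) = X^k * G in Z[X]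
   with G(0) != 0. For a prime p, take g = X^(p-1) * G^p, f(x) = g(c * x) and
   F = f + f' + f'' + ... (Hermite). On the one hand
   sum_S F(b_S / c) = (p-1)! * (c^(p-1) * k * G(0)^p + p * m) with m an integer,
   which has modulus at least (p-1)! for p large. On the other hand it equals
   sum_S (F(b_S / c) - exp(b_S / c) * F(0)), which is O(B^p) for some B. *)

Set Implicit Arguments.
Unset Strict Implicit.
Unset Printing Implicit Defensive.

Import Order.TTheory GRing.Theory Num.Theory.
Import numFieldNormedType.Exports.

Local Open Scope ring_scope.
Local Open Scope complex_scope.

(** * Symmetric functions of the roots of an integer polynomial *)

Lemma map_poly_intr (A B : nzRingType) (f : {rmorphism A -> B}) (h : {poly int}) :
  map_poly f (map_poly intr h) = map_poly intr h.
Proof. by rewrite -map_poly_comp; apply: eq_map_poly => x; rewrite /= rmorph_int. Qed.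

Section SymmetricFunctions.
Variables (K : fieldType) (n : nat) (a : n.-tuple K) (Q : {poly int}).
Hypothesis Qa : map_poly intr Q = \prod_(x <- a) ('X - x%:P).

Let ev : {mpoly int[n]} -> K := mmap intr (tnth a).

(** Vieta: up to sign, the coefficients of the monic polynomial [Q] are the elementary symmetric
    functions of its roots. *)
Lemma eval_mesym_int k : (k <= n)%N -> exists m : int, ev (mesym n int k) = m%:~R.
Proof.
move=> le_kn; exists ((-1) ^+ k * Q`_(n - k)).
have := mroots_coeff a (Ordinal (le_kn : (k < n.+1)%N)); rewrite -Qa coef_map /= => eQ.
rewrite rmorphM /= rmorphXn rmorphN1 eQ mulrA -exprMn mulrNN mulr1 expr1n mul1r.
rewrite /ev /mesym !raddf_sum /=; apply: eq_bigr => i _.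
rewrite !rmorph_prod; apply: eq_bigr => j _.
by rewrite /= mmapX mmap1U mevalXU.
Qed.

(** By the fundamental theorem of symmetric polynomials, [p] is an integer polynomial in the
    elementary ones, whose values are integers by Vieta. *)
Lemma eval_symmetric_int (p : {mpoly int[n]}) :
  p \is symmetric -> exists m : int, ev p = m%:~R.
Proof.
move=> p_sym; have [t [<- _]] := sym_fundamental p_sym.
have e_int (i : 'I_n) : exists m : int, ev (mesym n int i.+1) == m%:~R.
  by have [m ->] := eval_mesym_int (ltn_ord i); exists m.
exists (t.@[fun i => xchoose (e_int i)]).
rewrite comp_mpolyE /meval /mmap /ev !rmorph_sum /=; apply: eq_bigr => m _.
rewrite mmapZ !rmorphM /= /mmap1 rmorph_prod; congr (_ * _).
rewrite rmorph_prod /=; apply: eq_bigr => i _.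
by rewrite !rmorphXn tnth_mktuple /=; congr (_ ^+ _); apply/eqP/(xchooseP (e_int i)).
Qed.

Definition subset_sum (S : {set 'I_n}) : K := \sum_(j in S) tnth a j.

Let gen_sum (S : {set 'I_n}) : {mpoly int[n]} := \sum_(j in S) 'X_j.

Let ev_gen_sum S : ev (gen_sum S) = subset_sum S.
Proof.
rewrite /ev rmorph_sum /subset_sum; apply: eq_bigr => j _.
by rewrite /= mmapX mmap1U.
Qed.

Let msym_gen_sum s S : msym s (gen_sum S) = gen_sum (s @: S).
Proof.
rewrite /gen_sum rmorph_sum /= (big_imset _ (in2W perm_inj)) /=.
apply: eq_bigr => j _; rewrite msymX; congr 'X_[_]; apply/mnmP => i.
rewrite mnmE !mnm1E; congr (nat_of_bool _).
by rewrite -(inj_eq (@perm_inj _ s)) permKV.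
Qed.

Let reindex_imset (T : Type) (idx : T) (op : Monoid.com_law idx) (s : 'S_n)
    (F : {set 'I_n} -> T) :
  \big[op/idx]_(S : {set 'I_n}) F (s @: S) = \big[op/idx]_S F S.
Proof.
have inj_s : injective (fun S : {set 'I_n} => s @: S) := imset_inj (@perm_inj _ s).
by rewrite [RHS](reindex_inj inj_s).
Qed.

(** A permutation of the variables only permutes the generic subset sums [gen_sum S], so the sum of
    [h] over them is a symmetric polynomial. *)
Lemma sum_subset_sum_int (h : {poly int}) :
  exists m : int, \sum_(S : {set 'I_n}) (map_poly intr h).[subset_sum S] = m%:~R.
Proof.
have [|m evm] := @eval_symmetric_int (\sum_(S : {set 'I_n}) (map_poly intr h).[gen_sum S]).
  apply/issymP => s; rewrite rmorph_sum /= -[RHS](reindex_imset _ s).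
  by apply: eq_bigr => S _; rewrite -horner_map map_poly_intr /= msym_gen_sum.
exists m; rewrite -evm /ev rmorph_sum /=; apply: eq_bigr => S _.
by rewrite -horner_map map_poly_intr /= -/ev ev_gen_sum.
Qed.

(** The same symmetry, applied to each coefficient of the product taken over the generic subset
    sums. *)
Lemma prod_subset_sum_int :
  exists P : {poly int}, map_poly intr P = \prod_S ('X - (subset_sum S)%:P).
Proof.
pose G := \prod_S ('X - (gen_sum S)%:P).
have G_int i : exists m : int, ev G`_i == m%:~R.
  have [|m ->] := @eval_symmetric_int G`_i; last by exists m.
  apply/issymP => s; rewrite -coef_map; suff -> : map_poly (msym s) G = G by [].
  rewrite rmorph_prod /= -[RHS](reindex_imset _ s).
  by apply: eq_bigr => S _; rewrite rmorphB /= map_polyX map_polyC /= msym_gen_sum.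
exists (\poly_(i < size G) xchoose (G_int i)); apply/polyP => i.
have -> : \prod_S ('X - (subset_sum S)%:P) = map_poly ev G.
  rewrite rmorph_prod /=; apply: eq_bigr => S _.
  by rewrite rmorphB /= map_polyX map_polyC /= -/ev ev_gen_sum.
rewrite !coef_map coef_poly /=; case: ltnP => [_|/leq_sizeP -> //].
  by apply/esym/eqP/(xchooseP (G_int i)).
by rewrite /ev !rmorph0.
Qed.

End SymmetricFunctions.

(** * The complex exponential and Hermite's estimate *)

Section ComplexExponential.
Variable R : realType.
Local Notation Re := (@complex.Re R).
Local Notation Im := (@complex.Im R).
Implicit Types (z w b : R[i]) (t : R).

Let ReD z w : Re (z + w) = Re z + Re w. Proof. by case: z w => [? ?] []. Qed.
Let ImD z w : Im (z + w) = Im z + Im w. Proof. by case: z w => [? ?] []. Qed.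
Let ReM z w : Re (z * w) = Re z * Re w - Im z * Im w. Proof. by case: z w => [? ?] []. Qed.
Let ImM z w : Im (z * w) = Re z * Im w + Im z * Re w. Proof. by case: z w => [? ?] []. Qed.

Definition cexp z : R[i] := (expR (Re z))%:C * (cos (Im z) +i* sin (Im z)).

Lemma cexpD z w : cexp (z + w) = cexp z * cexp w.
Proof.
case: z w => [x y] [u v]; rewrite /cexp /= expRD cosD sinD rmorphM /=.
by apply/eqP; rewrite eq_complex /=; apply/andP; split; apply/eqP; ring.
Qed.

Lemma cexp0 : cexp 0 = 1.
Proof. by rewrite /cexp /= expR0 cos0 sin0 mul1r. Qed.

Lemma cexp_sum (I : Type) (r : seq I) (P : pred I) (F : I -> R[i]) :
  cexp (\sum_(i <- r | P i) F i) = \prod_(i <- r | P i) cexp (F i).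
Proof. exact: (big_morph cexp cexpD cexp0). Qed.

Lemma cexp_ipi : cexp (0 +i* pi) = -1.
Proof.
rewrite /cexp /= expR0 cospi sinpi mul1r.
by apply/eqP; rewrite eq_complex /= oppr0 !eqxx.
Qed.

Lemma norm_cexp z : `|cexp z| = (expR (Re z))%:C.
Proof.
rewrite /cexp normrM [X in X * _]ger0_norm ?ler0c ?expR_ge0 //.
by rewrite normc_def /= cos2Dsin2 sqrtr1 mulr1.
Qed.

(** Differentiation is along the real line and componentwise, so that the real derivation rules and
    the real mean value theorem apply. *)
Definition is_cderive (f : R -> R[i]) t (d : R[i]) :=
  is_derive t 1 (fun x => Re (f x)) (Re d) /\ is_derive t 1 (fun x => Im (f x)) (Im d).

Lemma is_cderive_cst z t : is_cderive (fun=> z) t 0.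
Proof. by split; exact: is_derive_cst. Qed.

Lemma is_cderive_id t : is_cderive (real_complex R) t 1.
Proof. by split; [exact: is_derive_id | exact: is_derive_cst]. Qed.

Lemma is_cderiveD f g t d e :
  is_cderive f t d -> is_cderive g t e -> is_cderive (fun x => f x + g x) t (d + e).
Proof.
move=> [fr fi] [gr gi]; split.
  have -> : (fun x => Re (f x + g x)) = (fun x => Re (f x)) + (fun x => Re (g x)).
    by apply/funext => x; rewrite fctE ReD.
  by rewrite ReD; apply: is_deriveD.
have -> : (fun x => Im (f x + g x)) = (fun x => Im (f x)) + (fun x => Im (g x)).
  by apply/funext => x; rewrite fctE ImD.
by rewrite ImD; apply: is_deriveD.
Qed.

Lemma is_cderiveM f g t d e : is_cderive f t d -> is_cderive g t e ->
  is_cderive (fun x => f x * g x) t (d * g t + f t * e).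
Proof.
move=> [fr fi] [gr gi]; split.
  have -> : (fun x => Re (f x * g x)) =
      (fun x => Re (f x)) * (fun x => Re (g x)) - (fun x => Im (f x)) * (fun x => Im (g x)).
    by apply/funext => x; rewrite !fctE ReM.
  apply: is_derive_eq; rewrite ReD !ReM.
  rewrite /GRing.scale /=; ring.
have -> : (fun x => Im (f x * g x)) =
    (fun x => Re (f x)) * (fun x => Im (g x)) + (fun x => Im (f x)) * (fun x => Re (g x)).
  by apply/funext => x; rewrite !fctE ImM.
apply: is_derive_eq; rewrite ImD !ImM.
rewrite /GRing.scale /=; ring.
Qed.

Lemma is_cderive_horner (p : {poly R[i]}) t :
  is_cderive (fun x => p.[x%:C]) t p^`().[t%:C].
Proof.
elim/poly_ind: p => [|p c IHp].
  have -> : (fun x => (0 : {poly R[i]}).[x%:C]) = fun=> 0.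
    by apply/funext => x; rewrite horner0.
  by rewrite deriv0 horner0; exact: is_cderive_cst.
have -> : (fun x => (p * 'X + c%:P).[x%:C]) = fun x => p.[x%:C] * x%:C + c.
  by apply/funext => x; rewrite !hornerE.
have := is_cderiveD (is_cderiveM IHp (is_cderive_id t)) (is_cderive_cst c t).
by rewrite derivD derivC derivM derivX addr0 !hornerE.
Qed.

Lemma is_cderive_cexp b t :
  is_cderive (fun x => cexp (x%:C * b)) t (b * cexp (t%:C * b)).
Proof.
have scale_derive (g : R -> R) dg u :
    is_derive (t * u) 1 g dg -> is_derive t 1 (fun x => g (x * u)) (dg * u).
  move=> g_t; apply: (@is_derive1_comp _ g (fun x => x * u)) => //.
  have -> : (fun x => x * u) = u *: (@id R) by apply/funext => x; rewrite fctE mulrC.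
  by apply: is_derive_eq; rewrite /GRing.scale /= mulr1.
have cexpE x : cexp (x%:C * b) =
    (expR (x * Re b))%:C * (cos (x * Im b) +i* sin (x * Im b)).
  by rewrite /cexp ReM ImM /= !mul0r subr0 addr0.
have -> : (fun x => cexp (x%:C * b)) = fun x => (expR (x * Re b))%:C *
    (cos (x * Im b) +i* sin (x * Im b)) by apply/funext.
rewrite cexpE.
pose de : R[i] := (expR (t * Re b) * Re b)%:C.
pose dc : R[i] := (- sin (t * Im b) * Im b) +i* (cos (t * Im b) * Im b).
have -> : b * ((expR (t * Re b))%:C * (cos (t * Im b) +i* sin (t * Im b))) =
    de * (cos (t * Im b) +i* sin (t * Im b)) + (expR (t * Re b))%:C * dc.
  rewrite /de /dc; case: (b) => u v; apply/eqP; rewrite eq_complex /=.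
  by apply/andP; split; apply/eqP; ring.
apply: (@is_cderiveM (fun x => (expR (x * Re b))%:C)
  (fun x => cos (x * Im b) +i* sin (x * Im b))); split=> /=.
- exact: scale_derive.
- exact: is_derive_cst.
- exact: scale_derive.
- exact: scale_derive.
Qed.

Let norm_i : `|'i%C : R[i]| = 1. Proof. by rewrite complexiE normCi. Qed.

Lemma norm_real_complex t : `|t%:C : R[i]| = `|t|%:C.
Proof. by rewrite normc_def /= expr0n addr0 sqrtr_sqr. Qed.

Lemma norm_Re_le z (M : R) : `|z| <= M%:C -> `|Re z| <= M.
Proof. by move=> zM; rewrite -lecR (le_trans (normc_ge_Re z)). Qed.

Lemma norm_Im_le z (M : R) : `|z| <= M%:C -> `|Im z| <= M.
Proof.
move=> zM; have -> : Im z = - Re (z * 'i%C) by rewrite ReiNIm opprK.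
by rewrite normrN norm_Re_le // normrM norm_i mulr1.
Qed.

(* The componentwise mean value theorem loses a factor 2. *)
Lemma cmean_value (f df : R -> R[i]) (M : R) :
    (forall t, is_cderive f t (df t)) ->
    (forall t, 0 <= t <= 1 -> `|df t| <= M%:C) ->
  `|f 1 - f 0| <= (M *+ 2)%:C.
Proof.
move=> f_df df_le.
have mv (g dg : R -> R) : (forall t, is_derive t 1 g (dg t)) ->
    (forall t, 0 <= t <= 1 -> `|dg t| <= M) -> `|g 1 - g 0| <= M.
  move=> g_dg dg_le; have [|c c01 ->] := @MVT _ g dg 0 1 ltr01.
  - by apply: derivable_within_continuous => t _; case: (g_dg t).
  - by rewrite subr0 mulr1 dg_le //; move: c01; rewrite in_itv /= => /andP[/ltW -> /ltW].
have Re_le := mv _ _ (fun t => (f_df t).1) (fun t t01 => norm_Re_le (df_le t t01)).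
have Im_le := mv _ _ (fun t => (f_df t).2) (fun t t01 => norm_Im_le (df_le t t01)).
rewrite [f 1 - f 0]complexE (le_trans (ler_normD _ _)) // normrM norm_i mul1r mulr2n rmorphD.
have [-> ->] : Re (f 1 - f 0) = Re (f 1) - Re (f 0) /\ Im (f 1 - f 0) = Im (f 1) - Im (f 0).
  by case: (f 1) (f 0) => [? ?] [].
by rewrite lerD // norm_real_complex lecR.
Qed.

(** This is the full sum p + p' + p'' + ..., since derivatives of order at least [size p] vanish. *)
Definition sum_deriv (p : {poly R[i]}) : {poly R[i]} := \sum_(k < size p) p^`(k).

Lemma deriv_sum_deriv p : (sum_deriv p)^`() = sum_deriv p - p.
Proof.
rewrite /sum_deriv raddf_sum /=.
case sz_p: (size p) => [|n].
  by move/eqP: sz_p; rewrite size_poly_eq0 => /eqP ->; rewrite !big_ord0 subr0.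
rewrite big_ord_recr /= [in RHS]big_ord_recl /= -derivnS derivn_poly0 ?sz_p // addr0.
by rewrite [p + _]addrC addrK.
Qed.

(* With [F := sum_deriv f], the function [cexp (- t * b) * F.[t * b]] has derivative
   [- b * cexp (- t * b) * f.[t * b]]. *)
Lemma hermite_bound b : exists2 A : R, 0 <= A & forall (f : {poly R[i]}) (M : R),
    (forall t, 0 <= t <= 1 -> `|f.[t%:C * b]| <= M%:C) ->
  `|(sum_deriv f).[b] - cexp b * (sum_deriv f).[0]| <= (A * M)%:C.
Proof.
(* [expR (Re b)] is the modulus of the final factor [cexp b], the next two factors bound
   [b * cexp (- t * b)] on [0, 1], and the 2 comes from [cmean_value]. *)
pose A := expR (Re b) * Re `|b| * expR `|Re b| *+ 2.
have Re_b : (Re `|b|)%:C = `|b| by rewrite RRe_real ?normr_real.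
exists A => [|f M fM].
  by rewrite mulrn_wge0 // !mulr_ge0 ?expR_ge0 // -lecR Re_b normr_ge0.
pose F := sum_deriv f; pose q := F \Po (b *: 'X).
pose h t := cexp (t%:C * - b) * q.[t%:C].
pose dh t := - b * cexp (t%:C * - b) * f.[t%:C * b].
have h_dh t : is_cderive h t (dh t).
  have := is_cderiveM (is_cderive_cexp (- b) t) (is_cderive_horner q t).
  congr is_cderive.
  rewrite /q /dh; move: (cexp _) => e.
  rewrite deriv_comp derivZ derivX deriv_sum_deriv hornerM !horner_comp hornerD hornerN.
  rewrite !hornerZ hornerX hornerC [b * t%:C]mulrC; ring.
have M_ge0 : 0 <= M by rewrite -ler0c (le_trans _ (fM 0 _)) // lexx ler01.
have dh_le t : 0 <= t <= 1 -> `|dh t| <= (Re `|b| * expR `|Re b| * M)%:C.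
  move=> t01; rewrite /dh 2!normrM normrN norm_cexp !rmorphM /= Re_b.
  apply: ler_pM; rewrite ?normr_ge0 ?fM //.
    by rewrite mulr_ge0 ?normr_ge0 // ler0c expR_ge0.
  rewrite ler_wpM2l ?normr_ge0 // lecR ler_expR.
  have -> : Re (t%:C * - b) = - (t * Re b) by case: (b) => u v /=; ring.
  case/andP: t01 => t0 t1; rewrite (le_trans (ler_norm _)) // normrN normrM.
  by rewrite ger0_norm // ler_piMl ?normr_ge0.
have -> : F.[b] - cexp b * F.[0] = cexp b * (h 1 - h 0).
  rewrite /h mulrBr mulrA -cexpD mul1r subrr cexp0 mul1r mul0r cexp0 mul1r.
  by rewrite /q !horner_comp !hornerE.
rewrite normrM norm_cexp.
have -> : A * M = expR (Re b) * ((Re `|b| * expR `|Re b| * M) *+ 2) by rewrite /A; ring.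
rewrite [X in _ <= X]rmorphM /=; apply: ler_wpM2l; first by rewrite ler0c expR_ge0.
exact: cmean_value h_dh dh_le.
Qed.

End ComplexExponential.

(** * Arithmetic of Hermite's sum *)

(** Each differentiation lowers the exponent of [v] by at most one. *)
Lemma derivn_mul_exp (A : comNzRingType) (u v : {poly A}) i m :
  exists w, (u * v ^+ (i + m))^`(i) = w * v ^+ m.
Proof.
elim: i u m => [|i IHi] u m; first by exists u.
have [w eq_w] := IHi (u^`() * v + u * v^`() *+ (i + m).+1) m.
exists w; rewrite -eq_w derivSn derivM deriv_exp addSn /=; congr (_^`(i)).
by rewrite exprS mulrDl !mulrA mulrnAr mulrnAl mulrA.
Qed.

Section HermiteSum.
Variables (K : comNzRingType) (I : finType) (b : I -> K) (G : {poly int}) (c : int) (n : nat).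
Local Notation toK := (map_poly (intr : int -> K)).
Hypothesis sum_int : forall h, exists m : int, \sum_x (toK h).[b x] = m%:~R.
Hypothesis G_root : forall x, b x != 0 -> (toK G).[b x] = 0.

(** Here [n] plays the role of p - 1, which avoids predecessors. *)
Definition hermite_poly : {poly int} := 'X^n * G ^+ n.+1.
Local Notation g := hermite_poly.

Lemma sum_derivn_hermite i : exists m : int, \sum_x (toK g)^`(i).[b x] =
  (n`!%:Z * ((i == n)%:Z * (#|[set x | b x == 0]|%:Z * G`_0 ^+ n.+1) + n.+1%:Z * m))%:~R.
Proof.
(* A nonzero [b x] is a root of [G], hence a root of [g] of multiplicity at least [n.+1], which
   exceeds [i]. *)
have g_vanish x : b x != 0 -> (i <= n)%N -> (toK g)^`(i).[b x] = 0.
  move=> bx0 le_in; have [w] := derivn_mul_exp 'X^n G i (n.+1 - i).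
  rewrite subnKC 1?leqW // subSn // -/hermite_poly => g_i.
  by rewrite derivn_map g_i rmorphM rmorphXn hornerM horner_exp G_root // exprS mul0r mulr0.
have [lt_in|lt_ni|i_n] := ltngtP i n.
(* Order below [n]: where [b x = 0], the factor ['X^n] still makes the derivative vanish. *)
- exists 0; rewrite mul0r mulr0 addr0 mulr0 big1 // => x _.
  have [bx0|] := eqVneq (b x) 0; last by move/g_vanish; apply; exact: ltnW.
  have [w] := derivn_mul_exp (G ^+ n.+1) 'X i (n - i).
  rewrite subnKC 1?ltnW // mulrC -/hermite_poly => g_i.
  rewrite derivn_map g_i rmorphM rmorphXn hornerM horner_exp bx0 /= map_polyX hornerX.
  by rewrite expr0n subn_eq0 leqNgt lt_in mulr0.
(* Order above [n]: the derivative is [i!] times the normalized derivative, which has integer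
   coefficients, and [i!] is a multiple of [(n+1)!]. *)
- have [m sum_m] := sum_int g^`N(i).
  have /dvdnP[q i_fact] : (n.+1`! %| i`!)%N.
    by rewrite -(bin_fact lt_ni) dvdn_mull // dvdn_mulr // dvdnn.
  exists (q%:Z * m); rewrite mul0r add0r.
  rewrite derivn_map nderivn_def.
  transitivity ((m *+ i`!)%:~R : K); last first.
    congr intr; rewrite i_fact factS -mulr_natr natz !PoszM.
    by move: (Posz n`!) (Posz n.+1) (Posz q) => x y z; ring.
  rewrite [RHS]rmorphMn /= -sum_m -sumrMnl; apply: eq_bigr => x _.
  by rewrite rmorphMn /= hornerMn.
(* Order [n]: only the [x] with [b x = 0] contribute, each giving [n!] times the lowest coefficient
   of [G ^+ n.+1]. *)
- exists 0; rewrite mulr0 addr0 mul1r.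
  rewrite (bigID (fun x => b x == 0)) /= [X in _ + X]big1 ?addr0; last first.
    by move=> x bx0; rewrite g_vanish // i_n.
  transitivity (\sum_(x | b x == 0) (n`!%:Z * G`_0 ^+ n.+1)%:~R : K).
    apply: eq_bigr => x /eqP ->.
    rewrite derivn_map horner_coef0 coef_map coef_derivn addn0 i_n ffactnn.
    by rewrite /g coefXnM ltnn subnn -!horner_coef0 horner_exp -mulr_natl natz.
  rewrite sumr_const -rmorphMn /= cardsE.
  congr intr; rewrite -mulr_natr natz.
  by move: (Posz n`!) (Posz #|_|) (G`_0 ^+ n.+1) => x y z; ring.
Qed.

(** The weights [c ^+ i] are the chain rule factors of g(c * X). Only the order [n], included
    because [n < N], contributes a term that need not be a multiple of [(n+1)!]. *)
Lemma hermite_sum N : (n < N)%N -> exists m : int,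
  \sum_(i < N) c%:~R ^+ i * \sum_x (toK g)^`(i).[b x] =
  (n`!%:Z * (c ^+ n * #|[set x | b x == 0]|%:Z * G`_0 ^+ n.+1 + n.+1%:Z * m))%:~R.
Proof.
move=> lt_nN.
have /boolp.choice[m sum_m] := sum_derivn_hermite.
exists (\sum_(i < N) c ^+ i * m i).
under eq_bigr do rewrite sum_m -rmorphXn -rmorphM /=.
rewrite -rmorph_sum /=; congr intr.
rewrite mulr_sumr mulrDr [in RHS]mulr_sumr.
have -> : c ^+ n * #|[set x | b x == 0]|%:Z * G`_0 ^+ n.+1 =
    \sum_(i < N) c ^+ i * ((i == n :> nat)%:Z * (#|[set x | b x == 0]|%:Z * G`_0 ^+ n.+1)).
  rewrite (bigD1 (Ordinal lt_nN)) //= eqxx mul1r big1 ?addr0 ?mulrA // => i.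
  by rewrite -val_eqE /= => /negbTE ->; rewrite mul0r mulr0.
rewrite mulr_sumr -big_split /=; apply: eq_bigr => i _; ring.
Qed.

End HermiteSum.

(** Modulo the prime [n.+1] only the first term survives, and its factors [c], [k], [G0] are nonzero
    and smaller than the prime in absolute value. *)
Lemma coprime_term_neq0 (c G0 m : int) (k n : nat) : prime n.+1 ->
  c != 0 -> G0 != 0 -> (0 < k)%N -> (`|c| + `|G0| + k < n.+1)%N ->
  c ^+ n * k%:Z * G0 ^+ n.+1 + n.+1%:Z * m != 0.
Proof.
move=> p_prime c0 G00 k0 lt_p; apply/eqP => eq0.
have : (n.+1 %| absz (c ^+ n * k%:Z * G0 ^+ n.+1)%R)%N.
  suff : (n.+1%:Z %| c ^+ n * k%:Z * G0 ^+ n.+1)%Z by [].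
  by apply/dvdzP; exists (- m); rewrite mulNr [m * _]mulrC; apply/eqP; rewrite -addr_eq0 eq0.
have not_dvd a : (0 < a)%N -> (a <= `|c| + `|G0| + k)%N -> (n.+1 %| a)%N = false.
  by move=> a0 le_a; apply/negbTE/negP => /(dvdn_leq a0); rewrite leqNgt (leq_ltn_trans le_a).
rewrite !abszM !abszX !Euclid_dvdM // !Euclid_dvdX // !not_dvd ?absz_gt0 //.
- by rewrite -addnA addnCA leq_addr.
- by rewrite -lt0n.
- by rewrite leq_addl.
- by rewrite -addnA leq_addr.
Qed.

Lemma derivn_comp_scale (K : comNzRingType) (p : {poly K}) (c : K) i :
  (p \Po (c *: 'X))^`(i) = c ^+ i *: (p^`(i) \Po (c *: 'X)).
Proof.
elim: i => [|i IHi]; first by rewrite expr0 scale1r.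
rewrite derivnS IHi derivZ deriv_comp derivZ derivX -derivnS -[c *: 1]mulr1.
by rewrite alg_polyC mulr1 mulrC mul_polyC scalerA exprSr.
Qed.

Lemma norm_horner_le (K : numDomainType) (p : {poly K}) (z rho : K) :
  `|z| <= rho -> `|p.[z]| <= \sum_(i < size p) `|p`_i| * rho ^+ i.
Proof.
move=> z_rho; rewrite horner_coef (le_trans (ler_norm_sum _ _ _)) //.
apply: ler_sum => i _; rewrite normrM normrX ler_wpM2l ?normr_ge0 //.
by rewrite lerXn2r ?nnegrE ?normr_ge0 // (le_trans (normr_ge0 z)).
Qed.

(** * Lindemann's theorem for i*pi *)

Section Lindemann.
Variable R : realType.

Lemma fact_dominates (A B : R) : 0 <= A ->
  exists N, forall m, (N <= m)%N -> A * B ^+ m < m`!%:R.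
Proof.
move=> A0; have A1 : 0 < A + 1 by rewrite ltr_wpDl.
(* The general term of the exponential series tends to 0. The threshold uses [A + 1] because [A] may
   be 0. *)
have /cvgr0Pnorm_lt /(_ (A + 1)^-1) := cvg_exp_coeff B.
rewrite invr_gt0 => /(_ A1) [N _ ltN]; exists N => m /ltN /=.
have m0 : 0 < m`!%:R :> R by rewrite ltr0n fact_gt0.
rewrite /exp_coeff normrM [`|m`!%:R^-1|]gtr0_norm ?invr_gt0 // ltr_pdivrMr //.
rewrite mulrC ltr_pdivlMr // => Bm; apply: le_lt_trans Bm.
rewrite mulrC (le_trans (ler_norm _)) // normrM [`|A|]ger0_norm //.
by rewrite ler_wpM2l ?normr_ge0 // lerDl.
Qed.

Local Notation toC := (map_poly (intr : int -> R[i])).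

(** On the segment from 0 to [b], [rho] bounds the modulus of the scaled argument and [D] that of
    [G] there, so f is bounded by [rho ^+ n * D ^+ n.+1]; neither constant depends on [n]. *)
Lemma hermite_error (b c : R[i]) (G : {poly int}) : exists AB : R * R,
  [/\ 0 <= AB.1, 0 <= AB.2 & forall n,
    let F := sum_deriv (toC (hermite_poly G n) \Po (c *: 'X)) in
    `|F.[b] - cexp b * F.[0]| <= (AB.1 * AB.2 ^+ n)%:C].
Proof.
have [A A0 bound] := hermite_bound b.
pose rho := complex.Re `|c * b|.
have rhoE : rho%:C = `|c * b| by rewrite RRe_real ?normr_real.
have rho0 : 0 <= rho by rewrite -ler0c rhoE normr_ge0.
pose D := complex.Re (\sum_(i < size (toC G)) `|(toC G)`_i| * rho%:C ^+ i).
have DE : D%:C = \sum_(i < size (toC G)) `|(toC G)`_i| * rho%:C ^+ i.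
  by rewrite RRe_real // rpred_sum // => i _; rewrite rhoE realM ?realX ?normr_real.
have D0 : 0 <= D.
  by rewrite -ler0c DE sumr_ge0 // => i _; rewrite mulr_ge0 ?exprn_ge0 ?normr_ge0 ?ler0c.
exists (A * D, rho * D); split; rewrite ?mulr_ge0 //= => n.
have -> : A * D * (rho * D) ^+ n = A * (rho ^+ n * D ^+ n.+1) by rewrite exprMn exprS; ring.
apply: bound => t /andP[t0 t1].
have ctb : `|c * (t%:C * b)| <= rho%:C.
  rewrite mulrCA normrM rhoE norm_real_complex (ger0_norm t0) ler_piMl ?normr_ge0 //.
  by rewrite -[1]/(1%:C) lecR.
rewrite horner_comp hornerZ hornerX /hermite_poly rmorphM !rmorphXn /= map_polyX.
rewrite hornerM !horner_exp hornerX normrM !normrX rmorphM !rmorphXn /=.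
apply: ler_pM; rewrite ?exprn_ge0 ?normr_ge0 //.
  by rewrite lerXn2r ?nnegrE ?normr_ge0 ?ler0c.
by rewrite lerXn2r ?nnegrE ?normr_ge0 ?ler0c // DE norm_horner_le.
Qed.

Lemma exp_sum_neq0 (I : finType) (b : I -> R[i]) (x0 : I) (P : {poly int}) (c : int) :
    c != 0 -> b x0 = 0 -> toC P = \prod_x ('X - (b x)%:P) ->
    (forall h, exists m : int, \sum_x (toC h).[b x] = m%:~R) ->
  \sum_x cexp (b x / c%:~R) != 0.
Proof.
move=> c0 bx0 P_b sum_int; apply/eqP => sum0.
have c0C : c%:~R != 0 :> R[i] by rewrite intr_eq0.
have P0 : P != 0.
  apply: contra_neq (oner_neq0 R[i]) => P0.
  have : toC P \is monic by rewrite P_b monic_prod // => x _; exact: monicXsubC.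
  by rewrite P0 rmorph0 monicE lead_coef0 eq_sym => /eqP.
(* Splitting off the power of X leaves a [G] with nonzero constant term that vanishes at every
   nonzero [b x]. *)
have [mu [G]] := multiplicity_XsubC P 0.
rewrite P0 subr0 /root horner_coef0 implyTb => G00 P_G.
have G_root x : b x != 0 -> (toC G).[b x] = 0.
  move=> bx; apply/eqP; rewrite -(mulIr_eq0 _ (mulIf (expf_neq0 mu bx))).
  have -> : (toC G).[b x] * b x ^+ mu = (toC P).[b x].
    by rewrite P_G rmorphM rmorphXn /= map_polyX hornerM horner_exp hornerX.
  by rewrite P_b horner_prod (bigD1 x) //= hornerXsubC subrr mul0r.
(* The number of vanishing [b x] is positive thanks to [x0]. *)
pose k := #|[set x | b x == 0]|.
have k0 : (0 < k)%N by apply/card_gt0P; exists x0; rewrite inE bx0.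
pose F n := sum_deriv (toC (hermite_poly G n) \Po (c%:~R *: 'X)).
have /boolp.choice[AB bound] := fun x => hermite_error (b x / c%:~R) c%:~R G.
pose A := \sum_x (AB x).1; pose B := \sum_x (AB x).2.
have A0 : 0 <= A by rewrite sumr_ge0 // => x _; case: (bound x).
have sum_le n : `|\sum_x (F n).[b x / c%:~R]| <= (A * B ^+ n)%:C.
  (* The subtracted terms add up to [(F n).[0]] times the exponential sum, assumed to be 0. *)
  have -> : \sum_x (F n).[b x / c%:~R] =
      \sum_x ((F n).[b x / c%:~R] - cexp (b x / c%:~R) * (F n).[0]).
    by rewrite sumrB -mulr_suml sum0 mul0r subr0.
  rewrite (le_trans (ler_norm_sum _ _ _)) // /A mulr_suml rmorph_sum /=.
  apply: ler_sum => x _; case: (bound x) => A0x B0x /(_ n) /le_trans -> //.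
  rewrite lecR ler_wpM2l // lerXn2r ?nnegrE ?sumr_ge0 //.
    by move=> y _; case: (bound y).
  by rewrite /B (bigD1 x) //= lerDl sumr_ge0 // => y _; case: (bound y).
have [N domN] := fact_dominates B A0.
(* The prime must exceed both the threshold for the factorial to win and the bound required by
   [coprime_term_neq0]. *)
have [p ltp p_prime] := prime_above (N + (`|c| + `|G`_0| + k)).
case: p ltp p_prime => // n ltn_p p_prime.
(* Scaling the variable by a nonzero [c] preserves the degree, so both sums of derivatives run over
   the same orders. *)
have szG : size (toC (hermite_poly G n) \Po (c%:~R *: 'X)) = size (hermite_poly G n).
  rewrite size_comp_poly2 ?size_scale ?size_polyX // size_map_poly_id0 //.
  rewrite intr_eq0 lead_coef_eq0 mulf_neq0 ?expf_neq0 ?polyX_eq0 //.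
  by apply: contraNneq G00 => ->; rewrite coef0.
have lt_n_sz : (n < size (hermite_poly G n))%N.
  rewrite ltnNge; apply/negP => /leq_sizeP /(_ n (leqnn n)) /eqP.
  by rewrite coefXnM ltnn subnn -horner_coef0 horner_exp horner_coef0 expf_eq0 (negbTE G00).
have [m sumF] := hermite_sum c sum_int G_root lt_n_sz.
have := sum_le n; rewrite lt_geF //.
have -> : \sum_x (F n).[b x / c%:~R] = \sum_(i < size (hermite_poly G n)) c%:~R ^+ i *
    \sum_x (toC (hermite_poly G n))^`(i).[b x].
  under [RHS]eq_bigr do rewrite mulr_sumr.
  rewrite exchange_big /=; apply: eq_bigr => x _.
  rewrite /F /sum_deriv szG horner_sum; apply: eq_bigr => i _.
  rewrite derivn_comp_scale hornerZ horner_comp hornerZ hornerX.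
  by rewrite [_ * (_ / _)]mulrC divfK.
rewrite sumF.
have M0 := coprime_term_neq0 m p_prime c0 G00 k0 (leq_ltn_trans (leq_addl _ _) ltn_p).
rewrite -/k -intr_norm normrM.
(* A nonzero integer multiple of [n!] has modulus at least [n!], which already exceeds the analytic
   bound. *)
apply: (@lt_le_trans _ _ (n`!%:R)).
  rewrite -[n`!%:R](rmorph_nat (real_complex R)) ltcR domN //.
  by rewrite -ltnS (leq_ltn_trans (leq_addr _ _) ltn_p).
rewrite -[n`!%:R]/(n`!%:Z%:~R) ler_int ger0_norm // ler_peMr //.
by rewrite -gtz0_ge1 normr_gt0.
Qed.

End Lindemann.

(** * Transcendence of pi and linear independence *)

Lemma integral_multiple (K : numFieldType) (x : K) : integralOver (@ratr K) x ->
  exists2 c : int, c != 0 & integralOver (intr : int -> K) (c%:~R * x).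
Proof.
case=> p p_monic; have [q [a a0 p_q]] := rat_poly_scale p; rewrite p_q => root_x.
have q0 : q != 0.
  apply: contraTneq p_monic => q0.
  by rewrite p_q q0 rmorph0 scaler0 monicE lead_coef0 eq_sym oner_eq0.
have {root_x p p_q p_monic} root_x : (map_poly intr q).[x] = 0 :> K.
  move: root_x; rewrite /root map_polyZ hornerZ mulf_eq0 -map_poly_comp /=.
  rewrite fmorph_eq0 invr_eq0 intr_eq0 (negbTE a0) => /eqP <-; congr (_.[x]).
  by apply: eq_map_poly => m; rewrite /= ratr_int.
exists (lead_coef q); first by rewrite lead_coef_eq0.
have lead_q : lead_coef q = q`_(size q).-1 by [].
have sz_q : size (map_poly (intr : int -> K) q) = size q.
  by rewrite size_map_poly_id0 // intr_eq0 lead_coef_eq0.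
(* A nonzero constant has no root, so the degree is some [d.+1]. *)
case sz: (size q).-1 => [|d].
  have /eqP/size_poly1P [k k0 q_k] : size q = 1%N.
    by move: q0 sz; rewrite -size_poly_gt0; case: (size q) => // n _ /= ->.
  by move: root_x k0; rewrite q_k map_polyC hornerC => /eqP; rewrite intr_eq0 => ->.
have szS : size q = d.+2 by rewrite -sz prednK // size_poly_gt0.
rewrite {}lead_q sz.
pose c := q`_d.+1.
(* This is c^d * q(X / c) with [c] the leading coefficient of [q]: it is monic with integer
   coefficients and vanishes at [c * x]. *)
exists ('X^(d.+1) + \poly_(i < d.+1) (q`_i * c ^+ (d - i))).
  by rewrite monicE lead_coefDl ?lead_coefXn // size_polyXn ltnS size_poly.
apply/eqP; rewrite rmorphD /= map_polyXn hornerD hornerXn.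
rewrite (@horner_coef_wide _ d.+1); last by rewrite (leq_trans (size_poly _ _)) // size_poly.
rewrite -/c; transitivity (c%:~R ^+ d * (map_poly intr q).[x]); last by rewrite root_x mulr0.
rewrite [in RHS]horner_coef sz_q szS [in RHS]big_ord_recr /= [in RHS]coef_map /=.
rewrite mulrDr addrC; congr (_ + _).
  rewrite mulr_sumr; apply: eq_bigr => i _.
  rewrite !coef_map coef_poly ltn_ord /= rmorphM rmorphXn /= exprMn.
  have -> : c%:~R ^+ d = c%:~R ^+ (d - i) * c%:~R ^+ i :> K.
    by rewrite -exprD subnK // -ltnS.
  ring.
by rewrite exprMn mulrA -exprSr.
Qed.

Lemma ipi_transcendental (R : realType) : ~ integralOver (@ratr R[i]) (0 +i* pi).
Proof.
case/integral_multiple => c c0 [Q Q_monic root_Q].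
have c0C : c%:~R != 0 :> R[i] by rewrite intr_eq0.
have [s Q_s] := closed_field_poly_normal (map_poly intr Q : {poly R[i]}).
move: Q_s; rewrite (monicP (monic_map _ Q_monic)) scale1r => Q_s.
have /tnthP[j0 ipi_j0] : c%:~R * (0 +i* pi) \in in_tuple s.
  by rewrite -root_prod_XsubC -Q_s.
have [P P_s] := prod_subset_sum_int (a := in_tuple s) Q_s.
(* The empty subset provides the index at which the subset sum is 0. *)
have sum_set0 : subset_sum (in_tuple s) set0 = 0 by exact: big_set0.
have /negP := exp_sum_neq0 c0 sum_set0 P_s (sum_subset_sum_int (a := in_tuple s) Q_s).
apply; apply/eqP.
(* Expanding the product chooses, for each [j], the exponential or 1, that is, a subset; the factor
   at [j0] is [cexp (0 +i* pi) + 1 = 0]. *)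
transitivity (\prod_j (cexp (tnth (in_tuple s) j / c%:~R) + 1)).
  rewrite bigA_distr; apply: eq_bigr => S _.
  by rewrite /subset_sum mulr_suml cexp_sum big_mkcond.
by rewrite (bigD1 j0) //= -ipi_j0 [_ * (0 +i* pi)]mulrC mulfK // cexp_ipi addNr mul0r.
Qed.

(** Since ['i] is a root of X^2 + 1, an algebraic pi would make i * pi algebraic. *)
Lemma pi_transcendental (R : realType) : ~ integralOver (@ratr R[i]) (pi : R)%:C.
Proof.
move=> pi_alg; apply: (@ipi_transcendental R).
have -> : 0 +i* pi = 'i%C * (pi : R)%:C.
  by apply/eqP; rewrite eq_complex /= !(mul0r, mulr0, mul1r, oppr0, add0r) !eqxx.
apply: integral_mul pi_alg; exists ('X^2 + 1).
  by rewrite monicE lead_coefDl ?lead_coefXn // size_polyXn size_poly1.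
rewrite rmorphD /= map_polyXn rmorph1 /root !hornerE.
by rewrite sqr_i addNr.
Qed.

Theorem theorem1p3 (R : realType) (r s : int) (hr : 1 <= r) (hrs : r < s) :
  lin_indep_over (@algebraic_integer R[i])
    [tuple (1 : R)%:C; (pi ^ r : R)%:C; (pi ^ s : R)%:C].
Proof.
case: r s hr hrs => [r|//] [s|//] hr hrs c c_int.
rewrite !big_ord_recl big_ord0 addr0 !(tnth_nth 0) /= mulr1 => rel.
have r0 : (0 < r)%N by [].
have lt_rs : (r < s)%N by [].
(* The relation says that pi is a root of [p], whose coefficients are algebraic; if [p] were
   nonzero, pi would be algebraic. *)
pose p : {poly R[i]} := (c ord0)%:P +
  (c (lift ord0 ord0) *: 'X^r + c (lift ord0 (lift ord0 ord0)) *: 'X^s).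
have c_alg i : integralOver (@ratr R[i]) (c i).
  have [q q_monic q_root] := c_int i; exists (map_poly intr q); first exact: monic_map.
  rewrite -map_poly_comp (eq_map_poly (g := intr)) // => m /=.
  by rewrite ratr_int.
have p0 : p = 0.
  apply/eqP; apply: contra_notT (@pi_transcendental R) => p_neq0.
  apply: (integral_root p_neq0).
    by rewrite /root !hornerD hornerC !hornerZ !hornerXn -!rmorphXn /= rel.
  apply/integral_poly => i; rewrite !coefD coefC !coefZ !coefXn.
  apply: integral_add; first by case: ifP => // _; exact: integral0.
  by apply: integral_add; apply: integral_mul => //; exact: integral_nat.
(* The exponents 0, [r] and [s] are distinct, so each scalar is a coefficient of [p]. *)
have coef_p i : p`_i = 0 by rewrite p0 coef0.
have c0 : c ord0 = 0.
  have := coef_p 0%N; rewrite !coefD coefC !coefZ !coefXn /=.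
  by rewrite !ltn_eqF // ?(ltn_trans r0) // !mulr0 !addr0.
have c1 : c (lift ord0 ord0) = 0.
  have := coef_p r; rewrite !coefD coefC !coefZ !coefXn eqxx (gtn_eqF r0).
  by rewrite (ltn_eqF lt_rs) mulr1 mulr0 addr0 add0r.
have c2 : c (lift ord0 (lift ord0 ord0)) = 0.
  have := coef_p s; rewrite !coefD coefC !coefZ !coefXn eqxx (gtn_eqF (ltn_trans r0 lt_rs)).
  by rewrite (gtn_eqF lt_rs) mulr1 mulr0 !add0r.
case=> [[|[|[|//]]] lt_i3].
- by rewrite -c0; congr c; exact: val_inj.
- by rewrite -c1; congr c; exact: val_inj.
- by rewrite -c2; congr c; exact: val_inj.
Qed.
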